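(* Let $G=(V,E)$ be a graph without isolated edges and with maximum degree $\Delta\geq 2$, and let $r\geq 2$ be an integer. Then $$\chi'_{\Sigma,r}(G)\leq 6\left(\frac{M_{\Delta,r}-1}{\Delta}+\Delta-1\right)+\Delta,$$ where $M_{\Delta,r}=1+\Delta+\Delta(\Delta-1)+\Delta(\Delta-1)^2+\ldots+\Delta(\Delta-1)^{r-1}$. Consequently $\chi'_{\Sigma,r}(G)\leq 6\Delta^{r-1}$ for $r\geq 4$, while $\chi'_{\Sigma,3}(G)\leq 6\Delta^2+\Delta$ and $\chi'_{\Sigma,2}(G)\leq 13\Delta-6$.
   Context: Graphs are finite and simple. An isolated edge is a connected component isomorphic to $K_2$. For a proper edge colouring $c:E\to\{1,2,\ldots,k\}$ and a vertex $v$, the sum at $v$ is $d_c(v)=\sum_{e\ni v}c(e)$. For a positive integer $r$ and a graph $G$ without isolated edges, the $r$-distant sum distinguishing index $\chi'_{\Sigma,r}(G)$ is the least integer $k$ such that there is a proper edge colouring $c:E\to\{1,2,\ldots,k\}$ with $d_c(u)\neq d_c(v)$ for every pair of vertices $u,v$ whose distance $d(u,v)$ in $G$ satisfies $1\leq d(u,v)\leq r$. *)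

(* Defs.v *)
From mathcomp Require Import all_boot.
From mathcomp Require Import zify.

Set Implicit Arguments.
Unset Strict Implicit.
Unset Printing Implicit Defensive.

Record sgraph := SGraph {
  vertex :> finType;
  adj : rel vertex;
  adj_sym : symmetric adj;
  adj_irr : irreflexive adj }.

Definition iso (G H : sgraph) : Prop :=
  exists2 f : G -> H, bijective f & forall x y, adj (f x) (f y) = adj x y.

Section Induced.
Variables (G : sgraph) (A : {set G}).
Let iadj : rel {x : G | x \in A} := fun x y => adj (val x) (val y).
Fact iadj_sym : symmetric iadj.
Proof. by move=> x y; apply: adj_sym. Qed.
Fact iadj_irr : irreflexive iadj.
Proof. by move=> x; apply: adj_irr. Qed.
Definition induced := SGraph iadj_sym iadj_irr.
End Induced.

Section Complete.
Variable n : nat.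
Let kadj : rel 'I_n := fun x y => x != y.
Fact kadj_sym : symmetric kadj.
Proof. by move=> x y; rewrite /kadj eq_sym. Qed.
Fact kadj_irr : irreflexive kadj.
Proof. by move=> x; rewrite /kadj eqxx. Qed.
Definition complete_graph := SGraph kadj_sym kadj_irr.
End Complete.

Definition component (G : sgraph) (x : G) : {set G} :=
  [set y | connect (@adj G) x y].

Definition no_isolated_edge (G : sgraph) : Prop :=
  forall x : G, ~ iso (induced (component x)) (complete_graph 2).

Definition degree (G : sgraph) (x : G) : nat := #|[set y | adj x y]|.

Definition max_degree (G : sgraph) : nat := \max_(x : G) degree x.

Definition edges (G : sgraph) : {set {set G}} :=
  [set [set x; y] | x : G, y : G in adj x].

Definition walk (G : sgraph) (n : nat) (u v : G) : bool :=
  [exists p : n.-tuple G, path (@adj G) u p && (last u p == v)].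

Lemma walkP (G : sgraph) (n : nat) (u v : G) :
  reflect (exists p : seq G, [/\ size p = n, path (@adj G) u p & last u p = v])
          (walk n u v).
Proof.
apply: (iffP existsP) => [[p /andP[Hp /eqP Hl]]|[p [Hs Hp Hl]]].
  by exists p; rewrite size_tuple.
by move/eqP: Hs => Hs; exists (Tuple Hs); rewrite /= Hp Hl eqxx.
Qed.

Lemma connect_walk (G : sgraph) (u v : G) :
  connect (@adj G) u v -> exists n, walk n u v.
Proof.
by case/connectP=> p Hp ->; exists (size p); apply/walkP; exists p.
Qed.

(* [None] stands for infinite distance. *)
Definition distance (G : sgraph) (u v : G) : option nat :=
  if @idP (connect (@adj G) u v) is ReflectT uv
  then Some (ex_minn (connect_walk uv)) else None.

Lemma distanceP (G : sgraph) (u v : G) (n : nat) :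
  distance u v = Some n <->
  walk n u v /\ forall m, walk m u v -> n <= m.
Proof.
rewrite /distance; case: {-}_ / idP => [uv|nuv]; last first.
  split=> // -[/walkP[p [_ Hp Hl]] _]; case: nuv; apply/connectP.
  by exists p.
case: ex_minnP => m Hm min_m; split=> [[<-]//|[Hn min_n]].
by congr Some; apply/eqP; rewrite eqn_leq min_m ?min_n.
Qed.

Section Colouring.
Variables (G : sgraph) (r k : nat) (c : {set G} -> nat).

Definition colours_in_range : bool := [forall e in edges G, 1 <= c e <= k].

Definition proper_colouring : bool :=
  [forall e in edges G, forall f in edges G,
     (e != f) && (e :&: f != set0) ==> (c e != c f)].

Definition vertex_sum (v : G) : nat := \sum_(e in edges G | v \in e) c e.

Definition within_distance (u v : G) : bool :=
  if distance u v is Some n then 1 <= n <= r else false.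

Definition distant_sum_distinguishing : bool :=
  [forall u, forall v, within_distance u v ==> (vertex_sum u != vertex_sum v)].

Definition valid_colouring : bool :=
  [&& colours_in_range, proper_colouring & distant_sum_distinguishing].

End Colouring.

(* A colouring is a map on all sets of vertices of which only the values on
   edges matter; bounding the codomain by 'I_k.+1 makes existence decidable. *)
Definition colourable (G : sgraph) (r k : nat) : bool :=
  [exists c : {ffun {set G} -> 'I_k.+1}, valid_colouring r k (fun e => c e)].

Lemma eq_valid_colouring (G : sgraph) (r k : nat) (c d : {set G} -> nat) :
  {in edges G, c =1 d} -> valid_colouring r k c = valid_colouring r k d.
Proof.
move=> cd; rewrite /valid_colouring; congr andb; last congr andb.
- by apply: eq_forallb_in => e He; rewrite cd.
- apply: eq_forallb_in => e He; apply: eq_forallb_in => f Hf.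
  by rewrite !cd.
have E v : vertex_sum c v = vertex_sum d v.
  by apply: eq_bigr => e /andP[/cd].
by apply: eq_forallb => u; apply: eq_forallb => v; rewrite !E.
Qed.

Lemma colourableP (G : sgraph) (r k : nat) :
  reflect (exists c : {set G} -> nat, valid_colouring r k c)
          (colourable G r k).
Proof.
apply: (iffP existsP) => -[c Hc]; first by exists (fun e : {set G} => c e : nat).
exists [ffun e => inord (c e)]; rewrite -(@eq_valid_colouring G r k c) //.
move=> e He; case/and3P: Hc => /forallP/(_ e)/implyP/(_ He)/andP[_ Hk] _ _.
by rewrite ffunE inordK.
Qed.

Lemma binary_inj (n : nat) (P Q : nat -> bool) :
  \sum_(i < n) P i * 2 ^ i = \sum_(i < n) Q i * 2 ^ i ->
  forall i, i < n -> P i = Q i.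
Proof.
elim: n P Q => [//|n IH] P Q.
have E (S : nat -> bool) : \sum_(i < n.+1) S i * 2 ^ i =
    S 0 + 2 * \sum_(i < n) S i.+1 * 2 ^ i.
  rewrite big_ord_recl muln1 big_distrr; congr (_ + _).
  by apply: eq_bigr => i _; rewrite /= /bump /= add1n expnS mulnCA.
rewrite !E; move: (IH (P \o succn) (Q \o succn)) => /=.
move: (\sum_(i < n) P i.+1 * _) (\sum_(i < n) Q i.+1 * _) => a b {}IH H.
have [P0 ab] : P 0 = Q 0 /\ a = b.
  by move: H; case: (P 0); case: (Q 0) => /= H; split=> //; lia.
by case=> [//|i]; apply: IH.
Qed.

Lemma binary_set_inj (T : finType) (A B : {set T}) :
  \sum_(x in A) 2 ^ enum_rank x = \sum_(x in B) 2 ^ enum_rank x -> A = B.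
Proof.
pose P (S : {set T}) (i : nat) := [exists x in S, enum_rank x == i :> nat].
have PE S (i : 'I_#|T|) : P S i = (enum_val i \in S).
  apply/exists_inP/idP => [[x Sx /eqP/val_inj <-]|Si].
    by rewrite enum_rankK.
  by exists (enum_val i) => //; rewrite enum_valK.
have E (S : {set T}) :
    \sum_(x in S) 2 ^ enum_rank x = \sum_(i < #|T|) P S i * 2 ^ i.
  rewrite big_mkcond (reindex _ (onW_bij _ (enum_val_bij T))) /=.
  apply: eq_bigr => i _; rewrite enum_valK PE.
  by case: (_ \in S); rewrite ?mul1n ?mul0n.
rewrite !E => /binary_inj H; apply/setP => x.
by have := H (enum_rank x) (ltn_ord _); rewrite !PE enum_rankK.
Qed.

Lemma edge_mem (G : sgraph) (x y : G) : adj x y -> [set x; y] \in edges G.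
Proof. by move=> xy; apply/imset2P; exists x y; rewrite ?inE. Qed.

Lemma same_edges_isolated (G : sgraph) (u v : G) :
  u != v -> connect (@adj G) u v ->
  (forall e, e \in edges G -> (u \in e) = (v \in e)) ->
  iso (induced (component u)) (complete_graph 2).
Proof.
move=> uv /connectP[p Hp Hl] H.
have Nu x : adj u x -> x = v.
  move=> ux; have := H _ (edge_mem ux); rewrite !inE eqxx /=.
  by rewrite eq_sym (negPf uv) /= => /esym/eqP.
have Nv x : adj v x -> x = u.
  move=> vx; have := H _ (edge_mem vx); rewrite !inE eqxx (negPf uv) /=.
  by move=> /eqP.
have auv : adj u v.
  case: p Hp Hl => [_ /= E|x p /= /andP[ux _] _]; first by rewrite E eqxx in uv.
  by rewrite -(Nu x ux).
have C x : (x \in component u) = (x \in [set u; v]).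
  rewrite !inE; apply/idP/orP => [/connectP[q Hq ->]|]; last first.
    by case=> /eqP->; rewrite ?connect0 ?connect1.
  suff S z : path (@adj G) z q -> z == u \/ z == v ->
      last z q == u \/ last z q == v by apply: (S u) => //; left.
  elim: q {Hq} z => [//|y q IH] z /= /andP[zy Hq] Hz; apply: IH Hq _.
  case: Hz zy => /eqP-> => [/Nu->|/Nv->]; rewrite !eqxx; [by right | by left].
have Cu : u \in component u by rewrite C !inE eqxx.
have Cv : v \in component u by rewrite C !inE eqxx orbT.
pose f (x : induced (component u)) : complete_graph 2 :=
  if val x == u then ord0 else ord_max.
pose g (i : complete_graph 2) : induced (component u) :=
  if i == ord0 :> 'I_2 then Sub u Cu else Sub v Cv.
have vu : (v == u) = false by rewrite eq_sym (negPf uv).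
exists f.
  exists g => [x|i]; rewrite /f /g.
    have := valP x; rewrite C !inE => /orP[]/eqP E; apply: val_inj;
    by rewrite /= E ?eqxx ?vu.
  case: (eqVneq (i : 'I_2) ord0) => [->|ni] /=; rewrite ?eqxx ?vu //.
  by apply: val_inj; case: i ni => [[|[|]]].
move=> x y; rewrite /f /=.
have := valP x; have := valP y; rewrite !C !inE.
by do 2![case/orP=> /eqP->]; rewrite ?eqxx ?vu ?adj_irr ?auv // adj_sym auv.
Qed.

Lemma colourable_exists (G : sgraph) (r : nat) :
  no_isolated_edge G -> exists k, colourable G r k.
Proof.
move=> niG; pose c (e : {set G}) := 2 ^ enum_rank e.
exists (\max_(e : {set G}) c e); apply/colourableP; exists c.
apply/and3P; split.
- by apply/forall_inP => e _; rewrite expn_gt0 /= leq_bigmax.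
- apply/forall_inP => e _; apply/forall_inP => f _; apply/implyP => /andP[ef _].
  apply: contra ef => /eqP/(expnI (ltnSn 1))/val_inj/enum_rank_inj->.
  exact: eqxx.
apply/forallP => u; apply/forallP => v; apply/implyP.
rewrite /within_distance; case Dn: (distance u v) => [n|//] /andP[n_gt0 _].
have [/walkP[p [Hs Hp Hl]] min_n] := (distanceP u v n).1 Dn.
apply/eqP => Esum; apply: (niG u); apply: (@same_edges_isolated G u v).
- apply: contraTneq n_gt0 => uv; rewrite -leqNgt; apply: min_n.
  by apply/walkP; exists [::]; rewrite uv.
- by apply/connectP; exists p.
have E w : vertex_sum c w =
    \sum_(e in [set e in edges G | w \in e]) 2 ^ enum_rank e.
  by apply: eq_bigl => e; rewrite !inE.
move: Esum; rewrite !E => /binary_set_inj/setP H e He.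
by have := H e; rewrite !inE He.
Qed.

Definition sum_dist_index (G : sgraph) (r : nat) (niG : no_isolated_edge G) :
  nat := ex_minn (colourable_exists r niG).

Definition moore_bound (D r : nat) : nat :=
  1 + \sum_(0 <= i < r) D * (D - 1) ^ i.

(* Main.v *)
Require Import Defs.
From mathcomp Require Import all_boot all_order all_algebra.
From mathcomp Require Import zify.
Set Implicit Arguments.
Unset Strict Implicit.
Unset Printing Implicit Defensive.

(** Write D for the maximum degree, N for the sum of the (D-1)^i with i < r, and
    take t about 2 (N + D - 1). A vertex x has at most [degree x * N] vertices
    within distance r. Following the method of Kalkowski, Karonski and Pfender
    for the irregularity strength, the vertices of a component are processed in
    such an order that all but the last two have a neighbour processed later.
    Edges at a vertex get pairwise distinct residues modulo t, so that colours
    may be moved by t without harming properness. When z is processed, its edges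
    to later vertices get their colours, from the middle third of [1, 3t], and
    its edges to earlier vertices may be moved by t, which lets the sum of each
    earlier end switch between two values p and p + t reserved for it. Each of
    the edges at z contributes about 2N possible values, which is enough to find
    a pair p, p + t for z that avoids the pairs of the earlier vertices nearby.
    The last two vertices u, v are adjacent; the colour of uv ranges over [1, 3t]
    and a count over its residue modulo t shows that the sums of u and v can be
    made to differ from all others and from each other. *)

(** * Pairs of naturals at distance [t], and sums of distinct choices *)

(* [lowered t y] is the smaller element of the pair [p, p + t] containing [y],
   the naturals being paired according to the parity of [y %/ t]. *)
Definition lowered (t y : nat) : nat := y - t * odd (y %/ t).

Lemma lowered_high t y : lowered t y + t * odd (y %/ t) = y.
Proof.
rewrite /lowered; case: (posnP (y %/ t)) => [->|q0]; first by rewrite muln0 subn0 addn0.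
rewrite subnK //; case: odd; rewrite ?muln0 // muln1.
by case: t q0 => [|t]; rewrite ?divn0 // divn_gt0.
Qed.

(** Lowering keeps the remainder and makes the quotient even; adding [t * b] only sets the last
    binary digit of that quotient, which lowering clears again. *)
Lemma lowered_raise t y (b : bool) :
  0 < t -> lowered t (lowered t y + t * b) = lowered t y.
Proof.
move=> t0; have E : lowered t y = (y %/ t - odd (y %/ t)) * t + y %% t.
  have := lowered_high t y; have := divn_eq y t.
  have : odd (y %/ t) <= y %/ t by case: (y %/ t) => // n; apply: leq_trans (leq_b1 _) _.
  by case: odd; nia.
have even_q : odd (y %/ t - odd (y %/ t)) = false.
  rewrite oddB; first by case: (odd (y %/ t)).
  by case: (y %/ t) => // n; apply: leq_trans (leq_b1 _) _.
rewrite E; move: (y %/ t - _) even_q => q even_q.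
have -> : q * t + y %% t + t * b = (q + b) * t + y %% t by nia.
rewrite /lowered divnMDl // divn_small ?ltn_pmod // addn0 oddD even_q oddb; nia.
Qed.

(* Induction on [s]: give the new index the minimum [m] of its list, then raise it
   on top of the largest sum obtained for the other indices. *)
Lemma realised_sums (T : eqType) (s : seq T) (L : T -> seq nat) (q b t : nat) :
  0 < q -> uniq s -> 0 < size s ->
  (forall x, x \in s -> uniq (L x)) ->
  (forall x a, x \in s -> a \in L x -> t < a <= 2 * t) ->
  (forall x, x \in s -> q + (size s).-1 <= size (L x)) ->
  exists Z : seq nat, [/\ uniq Z, q * b.+1 + (size s).-1 * q.-1 <= size Z &
    forall y, y \in Z -> exists (g : T -> nat) (j : nat),
      [/\ {in s, forall x, g x \in L x}, {in s &, injective g}, j <= b &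
          y = \sum_(x <- s) g x + j * t]].
Proof.
move=> q0; elim: s L => [//|x s IH] L /= /andP[xs us] _ uL wL szL.
case: (posnP (size s)) => s0.
  move/eqP: s0; rewrite size_eq0 => /eqP s0; subst s => /=.
  (* The entries of [L x] lie in a window of length [t], so distinct pairs [(a, j)] give distinct
     sums. *)
  exists [seq a + j * t | a <- L x, j <- iota 0 b.+1]; split.
  - apply: allpairs_uniq; rewrite ?iota_uniq ?uL ?mem_head //.
    move=> _ _ /allpairsP[[a1 j1] [a1L _ ->]] /allpairsP[[a2 j2] [a2L _ ->]] /=.
    move: a1L a2L => /= a1L a2L E.
    have := wL x a1 (mem_head _ _) a1L; have := wL x a2 (mem_head _ _) a2L.
    move=> H2 H1; have jj : j1 = j2 by nia.
    by subst j2; congr pair; lia.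
  - rewrite size_allpairs size_iota mul0n addn0 leq_mul2r; apply/orP; right.
    by have := szL x (mem_head _ _); rewrite /= addn0.
  move=> y /allpairsP; case=> -[a j] [aL jb ->]; exists (fun=> a), j.
  have {}aL : a \in L x := aL; have {}jb : j \in iota 0 b.+1 := jb.
  rewrite mem_iota in jb; split.
  - by move=> z; rewrite inE => /eqP->.
  - by move=> z w; rewrite !inE => /eqP-> /eqP->.
  - by lia.
  by rewrite big_seq1.
have Lx0 : 0 < size (L x).
  by have := szL x (mem_head _ _); rewrite /=; lia.
have [m mL mmin] : exists2 m, m \in L x & forall a, a \in L x -> m <= a.
  have exm : exists m, m \in L x by exists (nth 0 (L x) 0); rewrite mem_nth.
  by case: (ex_minnP exm) => m mL mm; exists m.
have xsI y : y \in s -> y \in x :: s by rewrite inE orbC => ->.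
(* With [m] removed from the other lists, using it at [x] keeps the choice injective; the entry lost
   is the one that the shorter index list no longer requires. *)
have [y ys|y a ys|y ys|Z [uZ szZ ZP]] := IH (fun y => [seq a <- L y | a != m]) us s0.
- exact/filter_uniq/uL/xsI.
- by rewrite mem_filter => /andP[_]; apply: wL (xsI _ ys).
- have := szL y (xsI _ ys); have := count_predC (pred1 m) (L y).
  rewrite (count_uniq_mem m (uL y (xsI _ ys))) size_filter.
  have -> : count (fun a => a != m) (L y) = count (predC (pred1 m)) (L y) by [].
  by move: s0; case: (m \in L y) => /=; rewrite ?add1n ?add0n; lia.
have [M MZ Mmax] : exists2 M, M \in Z & forall y, y \in Z -> y <= M.
  have exM : exists M, M \in Z.
    case: (Z) szZ => [|z Z'] szZ; last by exists z; rewrite mem_head.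
    by move: szZ; rewrite /= leqNgt addn_gt0 muln_gt0 q0.
  have bZ y : y \in Z -> y <= \max_(z <- Z) z by move=> yZ; apply: leq_bigmax_seq.
  by case: (ex_maxnP exM bZ) => M MZ mm; exists M.
have [g0 [j0 [g0L g0inj j0b ME]]] := ZP M MZ.
pose ext := [seq a + M | a <- L x & (a != m) && (a \notin map g0 s)].
exists ([seq m + y | y <- Z] ++ ext); split.
- rewrite cat_uniq !map_inj_uniq ?filter_uniq ?uL ?mem_head ?uZ //=; last 2 first.
  + by move=> a b' /addIn.
  + by move=> a b' /addnI.
  rewrite andbT; apply/hasPn => y /mapP[a]; rewrite mem_filter.
  move=> /andP[/andP[am _] aL] ->; apply/negP => /mapP[y' /Mmax y'M].
  by have := mmin a aL; lia.
- rewrite size_cat size_map size_map size_filter.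
  have H : size (L x) <= count (fun a => (a != m) && (a \notin map g0 s)) (L x)
      + size (m :: map g0 s).
    rewrite -(count_predC (fun a => (a != m) && (a \notin map g0 s)) (L x)) leq_add2l.
    rewrite -size_filter; apply: uniq_leq_size; first by rewrite filter_uniq ?uL ?mem_head.
    move=> a; rewrite mem_filter /= => /andP[+ _].
    by rewrite negb_and !negbK inE.
  have := szL x (mem_head _ _); move: H szZ; rewrite /= size_map; nia.
move=> y; rewrite mem_cat => /orP[|] /mapP[].
  move=> y' /ZP[g [j [gL ginj jb ->]]] ->.
  exists (fun z => if z == x then m else g z), j; split=> //.
  - move=> z; rewrite inE; case: eqP => [-> _|_ /=] //.
    by move/gL; rewrite mem_filter => /andP[].
  - move=> z w; rewrite !inE.
    case: (eqVneq z x) => [->|zx]; case: (eqVneq w x) => [->|wx] //=.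
    + by move=> _ /gL; rewrite mem_filter => /andP[/negP+ _] E; case; rewrite E.
    + by move=> /gL + _ E; rewrite mem_filter E eqxx.
    exact: ginj.
  rewrite big_cons eqxx addnA; congr (_ + _ + _).
  by apply: eq_big_seq => z zs; case: eqP => // zx; rewrite -zx zs in xs.
move=> a; rewrite mem_filter => /andP[/andP[am ag] aL] ->.
exists (fun z => if z == x then a else g0 z), j0; split=> //.
- move=> z; rewrite inE; case: eqP => [-> _|_ /=] //.
  by move/g0L; rewrite mem_filter => /andP[].
- move=> z w; rewrite !inE.
  case: (eqVneq z x) => [->|zx]; case: (eqVneq w x) => [->|wx] //=.
  + by move=> _ ws E; case/negP: ag; apply/mapP; exists w.
  + by move=> zs _ E; case/negP: ag; apply/mapP; exists z.
  exact: g0inj.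
rewrite big_cons eqxx ME addnA; congr (_ + _ + _).
by apply: eq_big_seq => z zs; case: eqP => // zx; rewrite -zx zs in xs.
Qed.

(** * Windows of consecutive integers *)

Lemma window_full (K : seq nat) (d n y : nat) :
  size K < d -> (forall l, n <= l < n + d -> (l \in K) || (l == y)) ->
  y :: K =i iota n d /\ y \notin K.
Proof.
move=> szK H; have sub : {subset iota n d <= y :: K}.
  by move=> l; rewrite mem_iota inE orbC => /H.
(* [y :: K] has at most [d] entries and contains all [d] integers of the window, so it has nothing
   to spare. *)
have := uniq_min_size (iota_uniq n d) sub; rewrite size_iota /= => /(_ szK)[sz E].
split=> [l|]; first by rewrite -E.
apply/negP => yK; have sub' : {subset iota n d <= K}.
  by move=> l /sub; rewrite inE => /predU1P[->|].
by have := uniq_leq_size (iota_uniq n d) sub'; rewrite size_iota leqNgt szK.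
Qed.

(* If all windows at three distinct points were covered, each of them would be
   [K] plus its point; the windows are then distinct, and two of them are at
   least two apart, so that two elements of one lie outside the other. *)
Lemma window_escape (Q : nat -> nat -> Prop) (K ys : seq nat) (d : nat) :
  1 < d -> size K < d -> uniq ys -> 0 < size ys ->
  (size K).+1 < d \/ 2 < size ys ->
  (forall y, y \in ys -> exists n, Q y n) ->
  exists y n l, [/\ y \in ys, Q y n, n <= l < n + d, l \notin K & l != y].
Proof.
move=> d1 szK uys ys0 Hor HQ.
pose good y n := has (fun l => (l \notin K) && (l != y)) (iota n d).
have fullP y n : ~~ good y n -> y :: K =i iota n d /\ y \notin K.
  move=> /hasPn H; apply: window_full szK _ => l Hl.
  have := H l; rewrite mem_iota => /(_ Hl).
  by rewrite negb_and !negbK.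
have finish y n : y \in ys -> Q y n -> good y n ->
    exists y n l, [/\ y \in ys, Q y n, n <= l < n + d, l \notin K & l != y].
  move=> yys Qyn /hasP[l]; rewrite mem_iota => ln /andP[lK ly].
  by exists y, n, l.
case: Hor => [szK1|sz3].
  have y0 : nth 0 ys 0 \in ys by rewrite mem_nth.
  have [n Qn] := HQ _ y0; apply: (finish _ n y0 Qn).
  apply: contraT => /fullP[E _].
  have sub : {subset iota n d <= nth 0 ys 0 :: K} by move=> x; rewrite E.
  by have := uniq_leq_size (iota_uniq n d) sub; rewrite size_iota leqNgt /= szK1.
case: ys uys {ys0} sz3 HQ finish => [|y1 [|y2 [|y3 ys]]] //.
rewrite /= !inE !negb_or => /and4P[/and3P[y12 y13 _] /andP[y23 _] _ _] _ HQ finish.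
have [|n1 Q1] := HQ y1; rewrite ?inE ?eqxx //.
have [|n2 Q2] := HQ y2; rewrite ?inE ?eqxx ?orbT //.
have [|n3 Q3] := HQ y3; rewrite ?inE ?eqxx ?orbT //.
case: (boolP (good y1 n1)) => [|/fullP[E1 K1]].
  by apply: finish; rewrite ?inE ?eqxx ?orbT.
case: (boolP (good y2 n2)) => [|/fullP[E2 K2]].
  by apply: finish; rewrite ?inE ?eqxx ?orbT.
case: (boolP (good y3 n3)) => [|/fullP[E3 K3]].
  by apply: finish; rewrite ?inE ?eqxx ?orbT.
have neq a b n n' : a != b -> a \notin K -> a :: K =i iota n d -> b :: K =i iota n' d ->
    n != n'.
  move=> ab aK Ea Eb; apply: contraNneq aK => nn; have := Ea a.
  by rewrite nn -Eb !inE eqxx (negPf ab).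
have far a b n n' : a :: K =i iota n d -> b :: K =i iota n' d -> n.+1 < n' -> False.
  move=> Ea Eb nn; have KE l : l \in K -> n' <= l.
    by move=> lK; have := Eb l; rewrite inE lK orbT mem_iota => /esym/andP[].
  have := Ea n; have := Ea n.+1; rewrite !inE !mem_iota.
  case: (boolP (n \in K)) => [/KE|_]; first by lia.
  by case: (boolP (n.+1 \in K)) => [/KE|_]; lia.
have := neq _ _ _ _ y12 K1 E1 E2; have := neq _ _ _ _ y13 K1 E1 E3.
have := neq _ _ _ _ y23 K2 E2 E3.
have := far _ _ _ _ E1 E2; have := far _ _ _ _ E2 E1; have := far _ _ _ _ E1 E3.
have := far _ _ _ _ E3 E1; have := far _ _ _ _ E2 E3; have := far _ _ _ _ E3 E2.
lia.
Qed.

(** * Vertices within bounded distance *)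

Lemma leq_card_bigcup (I T : finType) (P : pred I) (F : I -> {set T}) :
  #|\bigcup_(i | P i) F i| <= \sum_(i | P i) #|F i|.
Proof.
apply: (big_ind2 (fun (A : {set T}) n => #|A| <= n)) => [|A a B b HA HB|//].
  by rewrite cards0.
by rewrite (leq_trans (leq_card_setU A B)) ?leq_add.
Qed.

Section Ball.
Variables (G : sgraph) (D : nat).
Hypothesis degD : forall x : G, degree x <= D.

(* The vertices reached from [x] by non-backtracking walks of length at most
   [n] that do not start with a step to [p]. *)
Fixpoint branch (n : nat) (p x : G) : {set G} :=
  if n is m.+1 then x |: \bigcup_(y in [set y | adj x y] :\ p) branch m x y else [set x].

(** As [p] is itself a neighbour of [x], at most [D - 1] neighbours continue the walk, as in a tree
    with [D - 1] children at each vertex. *)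
Lemma card_branch n (p x : G) : adj x p -> #|branch n p x| <= \sum_(i < n.+1) (D - 1) ^ i.
Proof.
elim: n p x => [|n IH] p x xp /=; first by rewrite cards1 big_ord1.
have cN : #|[set y | adj x y] :\ p| <= D - 1.
  by have := degD x; rewrite /degree (cardsD1 p) inE xp; lia.
rewrite big_ord_recl /= cardsU1; apply: leq_add; first exact: leq_b1.
have -> : \sum_(i < n.+1) (D - 1) ^ bump 0 i = (D - 1) * \sum_(i < n.+1) (D - 1) ^ i.
  by rewrite big_distrr; apply: eq_bigr => i _; rewrite /= /bump /= add1n expnS.
apply: (leq_trans (leq_card_bigcup _ _)) .
apply: (@leq_trans (\sum_(y in [set y | adj x y] :\ p) \sum_(i < n.+1) (D - 1) ^ i)).
  by apply: leq_sum => y; rewrite !inE => /andP[_ xy]; apply: IH; rewrite adj_sym.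
by rewrite sum_nat_const leq_mul2r cN orbT.
Qed.

Lemma mem_branch n (p x : G) (q : seq G) :
  path (@adj G) x q -> uniq [:: p, x & q] -> size q <= n -> last x q \in branch n p x.
Proof.
elim: n p x q => [|n IH] p x [|y q] // pP; first by move=> _ _; rewrite inE.
  by move=> _ _; rewrite /= !inE eqxx.
move: pP; rewrite [last _ _]/= [branch _ _ _]/= inE.
move=> /= /andP[xy qP] /andP[]; rewrite !inE !negb_or => /and3P[px py pq] uq sz.
apply/orP; right; apply/bigcupP; exists y; first by rewrite !inE eq_sym py.
by apply: IH => //=; rewrite inE negb_or.
Qed.

(** Distance between 1 and [r], phrased by walks so that symmetry and counting avoid the
    option-valued minimum. *)
Definition near (r : nat) (x y : G) : bool :=
  (x != y) && [exists n : 'I_r.+1, walk n x y].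

Lemma nearP r (x y : G) :
  reflect (x <> y /\ exists p, [/\ path (@adj G) x p, last x p = y & size p <= r]) (near r x y).
Proof.
apply: (iffP andP) => [[/eqP xy /existsP[n /walkP[p [sz pP pl]]]]|[/eqP xy [p [pP pl sz]]]].
  by split=> //; exists p; split=> //; rewrite sz -ltnS.
split=> //; apply/existsP; exists (Ordinal (sz : size p < r.+1)).
by apply/walkP; exists p.
Qed.

Lemma near_sym r : symmetric (near r).
Proof.
suff H x y : near r x y -> near r y x by move=> x y; apply/idP/idP; apply: H.
move=> /nearP[xy [p [pP pl sz]]]; apply/nearP; split; first by move/esym.
exists (rev (belast x p)); rewrite size_rev size_belast; split=> //.
  by rewrite -pl rev_path; under eq_path do rewrite adj_sym.
by case: p {pP sz} pl => //= z p _; rewrite rev_cons last_rcons.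
Qed.

Lemma near_adj r (x y : G) : 0 < r -> adj x y -> near r x y.
Proof.
move=> r0 xy; apply/nearP; split; first by move=> E; rewrite E adj_irr in xy.
by exists [:: y]; rewrite /= xy.
Qed.

(** Used at the last edge: the neighbours of one end are among the near vertices counted for the
    other end. *)
Lemma near_adj2 r (x y z : G) : 1 < r -> adj x y -> adj y z -> x != z -> near r x z.
Proof.
move=> r0 xy yz xz; apply/nearP; split; first exact/eqP.
by exists [:: y; z]; rewrite /= xy yz.
Qed.

(** Shortening the walk to a path excludes backtracking, so a near vertex lies in the branch of some
    neighbour of [x]. *)
Lemma card_near r (x : G) :
  #|[set y | near r x y]| <= degree x * \sum_(i < r) (D - 1) ^ i.
Proof.
case: r => [|r].
  rewrite big_ord0 muln0 leqn0 cards_eq0; apply/eqP/setP => y; rewrite !inE.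
  apply/negbTE/negP => /nearP[xy [p [_ E sz]]]; apply: xy; move: sz E.
  by rewrite leqn0 size_eq0 => /eqP->.
apply: (@leq_trans #|\bigcup_(y in [set y | adj x y]) branch r x y|).
  apply/subset_leq_card/subsetP => y; rewrite inE => /nearP[xy [p [pP pl sz]]].
  case/shortenP: pP pl => q qP uq sub pl.
  case: q qP uq sub pl => [//|z q] /= /andP[xz qP] uq sub pl.
  apply/bigcupP; exists z; first by rewrite inE.
  rewrite -pl; apply: mem_branch => //.
  have uzq : uniq (z :: q) by case/andP: uq.
  by have := leq_trans (uniq_leq_size uzq sub) sz.
apply: (leq_trans (leq_card_bigcup _ _)).
apply: (@leq_trans (\sum_(y in [set y | adj x y]) \sum_(i < r.+1) (D - 1) ^ i)).
  by apply: leq_sum => y; rewrite !inE => xy; apply: card_branch; rewrite adj_sym.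
by rewrite sum_nat_const.
Qed.

End Ball.

(** * Counting residues modulo [t] *)

(* The case analysis behind the choice of the residue of the last edge: [a], [b]
   and [g] count the residues excluded because of too many forbidden values for
   [v], for both ends, and for [u] respectively. *)
Lemma bad_residues (a b g C N D du dv : nat) :
  1 < dv -> 0 < du <= dv -> dv <= D <= N ->
  2 * N + (2 < D) + (D - du) + (D - dv) <= C ->
  a * dv + b * (dv - 1) <= dv * N + (du + dv - 3) ->
  b * du + g * (du + 2) <= du * N + (du + dv - 3) ->
  a + b + g < C.
Proof.
move=> dv1 /andP[du0 dudv] /andP[dvD DN] HC HV HU; rewrite ltnNge; apply/negP => HF.
have gN : g < N by nia.
have [D2|D3] := leqP D 2.
  have dvE : dv = 2 by lia.
  have DE : D = 2 by lia.
  by subst dv D; case: du du0 dudv HU HV HC => [|[|[|]]] //= _ _; lia.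
rewrite D3 in HC; have Hb : b >= 3 by nia.
have aN : a < N by nia.
(* With [a = N - k - 1] and [dv = du + e], the bound on [C] forces [b + g >= N + 2 + e + k];
   multiplied by [du], this contradicts [HU]. *)
have [k ak] : exists k, N = a + k.+1 by exists (N - a.+1); lia.
have [e dvE] : exists e, dv = du + e by exists (dv - du); lia.
have H1 : b + g >= N + 2 + e + k by lia.
have H2 : (b + g) * du + 2 * g <= du * N + (du + dv - 3) by nia.
have H3 : du * (N + 2 + e + k) <= (b + g) * du by rewrite mulnC leq_mul2r H1 orbT.
have H4 : e <= du * e by rewrite -{1}[e]mul1n leq_mul2r du0 orbT.
rewrite !mulnDr in H3; lia.
Qed.

Lemma eq_mod_window t n a b :
  n <= a < n + t -> n <= b < n + t -> a %% t = b %% t -> a = b.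
Proof.
move=> Ha Hb E; have := divn_eq a t; have := divn_eq b t; rewrite E.
move: (a %/ t) (b %/ t) (b %% t) => i j r Eb Ea.
have ij : i = j by nia.
by rewrite Ea Eb ij.
Qed.

(** Residues are distinct on a window of length [t], so each entry of [fr] excludes at most one
    element. *)
Lemma size_avoid t n (fr : seq nat) :
  t <= size [seq a <- iota n t | a %% t \notin fr] + size fr.
Proof.
rewrite -{1}(size_iota n t) -(count_predC (fun a => a %% t \notin fr) (iota n t)).
rewrite size_filter leq_add2l -size_filter -(size_map (fun a => a %% t)).
apply: uniq_leq_size => [|r /mapP[a]]; last first.
  by rewrite mem_filter /= negbK => /andP[] /[swap] _ /[swap] ->.
rewrite map_inj_in_uniq ?filter_uniq ?iota_uniq //.
move=> a b; rewrite !mem_filter !mem_iota => /andP[_ Ha] /andP[_ Hb].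
exact: eq_mod_window Ha Hb.
Qed.

Lemma subset_of_card (T : finType) (A : {set T}) n :
  n <= #|A| -> exists2 B : {set T}, B \subset A & #|B| = n.
Proof.
move=> nA; exists [set x in take n (enum A)].
  by apply/subsetP => x; rewrite inE => /mem_take; rewrite mem_enum.
by rewrite cardsE (card_uniqP _) ?take_uniq ?enum_uniq // size_takel // -cardE.
Qed.

(** * Partial colourings *)

Section Weights.
Variables (G : sgraph) (t : nat).
Implicit Types (c : G -> G -> nat) (P R : {set G}) (phi : G -> nat) (x y z w : G).

Definition weight c x : nat := \sum_(w | adj x w) c x w.

Definition recolour z phi c x y : nat :=
  if x == z then phi y else if y == z then phi x else c x y.

Lemma recolour_sym z phi c :
  (forall x y, c x y = c y x) -> forall x y, recolour z phi c x y = recolour z phi c y x.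
Proof.
by move=> cs x y; rewrite /recolour; case: (eqVneq x z) => [->|_]; case: (eqVneq y z) => [E|_]; rewrite ?E.
Qed.

Lemma weight_recolour_self z phi c :
  weight (recolour z phi c) z = \sum_(w | adj z w) phi w.
Proof. by apply: eq_bigr => w _; rewrite /recolour eqxx. Qed.

Lemma weight_recolour_adj z phi c x :
  (forall x y, c x y = c y x) -> adj z x ->
  weight (recolour z phi c) x + c z x = weight c x + phi x.
Proof.
move=> cs zx; have xz : adj x z by rewrite adj_sym.
have nxz : x != z by apply: contraTneq zx => ->; rewrite adj_irr.
rewrite /weight (bigD1 z) //= [in RHS](bigD1 z) //= /recolour eqxx (negPf nxz) cs.
rewrite [in RHS]addnC addnA [in LHS]addnAC; congr (_ + _ + _); apply: eq_bigr => w /andP[_ wz].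
by rewrite (negPf wz).
Qed.

Lemma weight_recolour_nadj z phi c x :
  x != z -> ~~ adj z x -> weight (recolour z phi c) x = weight c x.
Proof.
move=> nxz zx; apply: eq_bigr => w xw; rewrite /recolour (negPf nxz).
by case: eqP => // wz; rewrite -wz adj_sym xw in zx.
Qed.

(** [R] selects the neighbours of [z] that end at the upper value of their pair. The hypothesis on
    [phi] is written additively to avoid truncated subtraction. *)
Lemma weight_flip P R z phi c :
  (forall x y, c x y = c y x) -> z \notin P ->
  (forall w, adj z w -> w \in P ->
     phi w + t * odd (weight c w %/ t) = c z w + t * (w \in R)) ->
  forall x, x \in P -> weight (recolour z phi c) x =
    if adj z x then lowered t (weight c x) + t * (x \in R) else weight c x.
Proof.
move=> cs zP H x xP; case: ifPn => zx.
  have := weight_recolour_adj phi cs zx; have := H x zx xP.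
  by have := lowered_high t (weight c x); lia.
by apply: weight_recolour_nadj zx; apply: contraNneq zP => <-.
Qed.

(** The [phi] that [weight_flip] asks for; the subtraction is exact once [t <= c z w]. *)
Definition flip c z R w : nat := c z w + t * (w \in R) - t * odd (weight c w %/ t).

Lemma flipE c z R w : t <= c z w ->
  flip c z R w + t * odd (weight c w %/ t) = c z w + t * (w \in R).
Proof. by move=> H; rewrite /flip subnK //; move: H; clear; case: odd; lia. Qed.

Lemma flip_mod c z R w : t <= c z w -> flip c z R w = c z w %[mod t].
Proof.
move=> /(flipE R)/(congr1 (modn^~ t)).
by rewrite /= ![_ + t * _]addnC ![t * _]mulnC !modnMDl.
Qed.

(** The reason for the middle third: one move by [t] either way stays within [[1, 3t]]. *)
Lemma flip_range c z R w : t < c z w <= 2 * t -> 0 < flip c z R w <= 3 * t.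
Proof.
move=> H; have /(flipE R) : t <= c z w by case/andP: H => /ltnW.
by move: H; clear; case: odd; case: (w \in R); lia.
Qed.

(** Only the size of [R] matters for the sum at [z], which therefore moves in steps of [t]. *)
Lemma sum_flip (B R : {set G}) c z : R \subset B -> (forall w, w \in B -> t <= c z w) ->
  \sum_(w in B) flip c z R w =
  \sum_(w in B) (c z w - t * odd (weight c w %/ t)) + t * #|R|.
Proof.
move=> RB tc.
transitivity (\sum_(w in B) (c z w - t * odd (weight c w %/ t) + t * (w \in R))).
  apply: eq_bigr => w wB; move: (flipE R (tc w wB)) (tc w wB).
  by clear; case: odd; lia.
rewrite big_split /= -big_distrr /=; congr (_ + _ * _).
rewrite -sum1_card [RHS](eq_bigl (fun w => (w \in B) && (w \in R))).
  by rewrite [RHS]big_mkcondr /=; apply: eq_bigr => w _; case: (w \in R).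
by move=> w; case: (boolP (w \in R)) => wR; rewrite ?andbF // (subsetP RB).
Qed.

Variable nr : rel G.

Definition coloured P x y : bool := (x \in P) || (y \in P).

(* A partial colouring assigns colours to the edges that meet the set [P] of
   processed vertices. The colour of an edge with one end in [P] may still be
   moved by [t] in either direction when its other end is processed; this swaps
   the weight of the end in [P] between two values with the same [lowered]. *)
Record partial P c : Prop := Partial {
  partial_sym : forall x y, c x y = c y x;
  partial_proper : forall x y w, adj x y -> adj x w -> y != w ->
    coloured P x y -> coloured P x w -> c x y %% t != c x w %% t;
  partial_mid : forall x y, adj x y -> x \in P -> y \notin P -> t < c x y <= 2 * t;
  partial_range : forall x y, adj x y -> x \in P -> y \in P -> 0 < c x y <= 3 * t;
  partial_lowered : forall x y, x \in P -> y \in P -> nr x y ->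
    lowered t (weight c x) != lowered t (weight c y) }.

Variables (D N : nat).
Hypotheses (degD : forall x : G, degree x <= D) (N0 : 0 < N)
  (nr_sym : symmetric nr) (nr_irr : irreflexive nr) (adj_nr : forall x y, adj x y -> nr x y)
  (card_nr : forall x, #|[set y | nr x y]| <= degree x * N)
  (tK : 2 * (N + D - 1) <= t).

(** Let [B] and [F] be the earlier and later neighbours of [z]. By [realised_sums] at least
    [2N * degree z - |F| + 1] sums are possible at [z]. As [F] fills part of the near vertices, the
    processed ones forbid at most [2 (N * degree z - |F|)] of them, and [z0] makes [F] non-empty. *)
Lemma partial_extend P c z z0 :
  partial P c -> z \notin P -> adj z z0 -> z0 \notin P ->
  exists c', partial (z |: P) c'.
Proof.
move=> [cs cp cm cr cl] zP zz0 z0P.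
pose B := [set w in P | adj z w]; pose F := [set w | adj z w] :\: P.
have z0F : z0 \in F by rewrite !inE z0P.
have D0 : 0 < D by apply: leq_trans (degD z); apply/card_gt0P; exists z0; rewrite inE.
have t0 : 0 < t by lia.
have BF : #|B| + #|F| = degree z.
  rewrite /degree -(cardsID P [set w | adj z w]); congr (_ + _).
  by apply: eq_card => w; rewrite !inE andbC.
have F0 : 0 < #|F| by apply/card_gt0P; exists z0.
pose fr w := [seq c w y %% t | y <- enum [set y in P | adj w y]] ++
             [seq c z y %% t | y <- enum B].
pose L w := [seq a <- iota t.+1 t | a %% t \notin fr w].
have [||||||Z [uZ szZ ZP]] := @realised_sums G (enum F) L (2 * N) #|B| t.
- by lia.
- exact: enum_uniq.
- by rewrite -cardE.
- by move=> w _; rewrite filter_uniq ?iota_uniq.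
- by move=> w a _; rewrite mem_filter mem_iota; lia.
(* At most [D - 1] residues are taken at [w] and [|B|] at [z], where [|B| + |F| <= D]. *)
- move=> w; rewrite mem_enum !inE => /andP[wP zw].
  have := size_avoid t t.+1 (fr w); rewrite size_cat !size_map -!cardE -/(L w).
  have : #|[set y in P | adj w y]| < D.
    apply: leq_trans (degD w); apply: proper_card; apply/properP; split.
      by apply/subsetP => y; rewrite !inE => /andP[].
    by exists z; rewrite !inE ?(negPf zP) // adj_sym.
  by have := degD z; lia.
rewrite -cardE in szZ.
pose S0 := \sum_(w in B) (c z w - t * odd (weight c w %/ t)).
pose Q := [set x in P | nr z x].
have QF : #|Q| + #|F| <= degree z * N.
  apply: leq_trans (card_nr z); rewrite -cardsUI.
  have -> : Q :&: F = set0 by apply/setP => x; rewrite !inE; case: (x \in P); rewrite ?andbF.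
  rewrite cards0 addn0; apply/subset_leq_card/subsetP => x; rewrite !inE.
  by case/orP => [/andP[]//|/andP[_ /adj_nr]].
have [y yZ yQ] : exists2 y, y \in Z &
    {in Q, forall x, lowered t (S0 + y) != lowered t (weight c x)}.
  (* Each near processed vertex forbids both values of its pair. *)
  pose kills := [seq lowered t (weight c x) | x <- enum Q] ++
                [seq lowered t (weight c x) + t | x <- enum Q].
  have : ~~ all (fun v => S0 + v \in kills) Z.
    apply/allP => sub.
    have : size [seq S0 + v | v <- Z] <= size kills.
      apply: uniq_leq_size => [|v /mapP[y /sub + ->] //].
      by rewrite map_inj_uniq // => a b /addnI.
    rewrite size_map size_cat !size_map -!cardE.
    by move: szZ QF; rewrite -BF; nia.
  case/allPn => y yZ yk; exists y => // x xQ; apply: contraNneq yk => E.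
  rewrite -(lowered_high t (S0 + y)) E mem_cat; case: odd; rewrite ?muln1 ?muln0 ?addn0.
    by apply/orP; right; apply/mapP; exists x; rewrite ?mem_enum.
  by apply/orP; left; apply/mapP; exists x; rewrite ?mem_enum.
have [g [j [gL ginj jB yE]]] := ZP y yZ.
(* The [j] steps of [t] in [y] are realised by raising [j] earlier neighbours. *)
have [R RB Rj] := subset_of_card jB.
pose phi w := if w \in P then flip c z R w else g w.
have midz w : adj z w -> w \in P -> t < c z w <= 2 * t.
  by move=> zw wP; rewrite cs; apply: cm; rewrite // adj_sym.
have tc w : adj z w -> w \in P -> t <= c z w.
  by move=> zw wP; case/andP: (midz w zw wP) => /ltnW.
have phiB w : adj z w -> w \in P -> phi w + t * odd (weight c w %/ t) = c z w + t * (w \in R).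
  by move=> zw wP; rewrite /phi wP flipE ?tc.
have gF w : adj z w -> w \notin P -> [/\ t < g w <= 2 * t, g w %% t \notin fr w & phi w = g w].
  move=> zw wP; have := gL w; rewrite mem_enum !inE wP zw => /(_ isT).
  rewrite mem_filter mem_iota /phi (negPf wP) => /andP[-> gw]; split=> //; move: gw; clear; lia.
have W := weight_flip cs zP phiB.
exists (recolour z phi c).
have phi_mod w : adj z w -> w \in P -> phi w %% t = c z w %% t.
  by move=> zw wP; rewrite /phi wP flip_mod ?tc.
have lowW x : x \in P -> lowered t (weight (recolour z phi c) x) = lowered t (weight c x).
  by move=> /W->; case: ifP => // _; rewrite lowered_raise.
have Wz : weight (recolour z phi c) z = S0 + y.
  rewrite weight_recolour_self (bigID (mem P)) /= yE addnA addnAC; congr (_ + _).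
    rewrite /S0 -Rj mulnC -sum_flip // => [|w]; last by rewrite !inE => /andP[wP zw]; apply: tc.
    by apply: eq_big => [w|w /andP[_ wP]]; [rewrite !inE andbC | rewrite /phi wP].
  rewrite big_enum /=; apply: eq_big => [w|w /andP[zw wP]]; first by rewrite !inE andbC.
  by rewrite /phi (negPf wP).
have nadjz w : adj z w -> (w == z) = false.
  by apply: contraTF => /eqP->; rewrite adj_irr.
have fresh w x : adj z w -> adj w x -> w \notin P -> x \in P -> g w %% t != c w x %% t.
  move=> zw wx wP xP; have [_ + _] := gF w zw wP; apply: contraNneq => ->.
  by rewrite mem_cat; apply/orP; left; apply/mapP; exists x; rewrite // mem_enum !inE xP.
have fresh_z w x : adj z w -> adj z x -> w \notin P -> x \in P -> g w %% t != c z x %% t.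
  move=> zw zx wP xP; have [_ + _] := gF w zw wP; apply: contraNneq => ->.
  by rewrite mem_cat; apply/orP; right; apply/mapP; exists x; rewrite // mem_enum !inE xP.
have beside x w : adj z x -> adj x w -> w != z -> coloured P x w -> phi x %% t != c x w %% t.
  move=> zx xw wz; rewrite /coloured; case: (boolP (x \in P)) => /= [xP _|xP wP].
    by rewrite phi_mod // cs; apply: cp; rewrite // /coloured ?xP // 1?eq_sym 1?adj_sym.
  by have [_ _ ->] := gF x zx xP; apply: fresh.
have apart y' w : adj z y' -> adj z w -> y' != w -> phi y' %% t != phi w %% t.
  move=> zy zw yw; case: (boolP (y' \in P)) (boolP (w \in P)) => yP [] wP.
  - by rewrite !phi_mod //; apply: cp; rewrite // /coloured ?yP ?wP orbT.
  - by have [_ _ ->] := gF w zw wP; rewrite phi_mod // eq_sym fresh_z.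
  - by have [_ _ ->] := gF y' zy yP; rewrite phi_mod // fresh_z.
  have [Hy _ ->] := gF y' zy yP; have [Hw _ ->] := gF w zw wP.
  apply: contraNneq yw => E; apply/eqP/ginj; rewrite ?mem_enum ?inE ?yP ?wP //.
  by apply: (@eq_mod_window t t.+1) E; [move: Hy | move: Hw]; clear; lia.
split.
- exact: recolour_sym.
- move=> x y' w xy xw yw; rewrite /coloured !in_setU1 /recolour.
  case: (eqVneq x z) xy xw => [->|xz] xy xw; first by move=> _ _; apply: apart.
  case: (eqVneq y' z) yw xy => [->|yz] yw xy; case: (eqVneq w z) yw xw => [->|wz] yw xw //=.
  + by move=> _ H; apply: beside; rewrite // adj_sym.
  + by move=> H _; rewrite eq_sym; apply: beside; rewrite // adj_sym.
  exact: cp.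
- move=> x y' xy; rewrite !in_setU1 negb_or /recolour => xP /andP[yz yP].
  case: (eqVneq x z) xP xy => [-> _ zy|xz /= xP xy]; first by have [? _ ->] := gF y' zy yP.
  by rewrite (negPf yz); apply: cm.
- move=> x y' xy; rewrite !in_setU1 /recolour.
  have phi_range w : adj z w -> w \in P -> 0 < phi w <= 3 * t.
    by move=> zw wP; rewrite /phi wP flip_range ?midz.
  case: (eqVneq x z) xy => [->|xz] xy; first by rewrite (nadjz _ xy) => _; apply: phi_range.
  case: (eqVneq y' z) xy => [->|yz] xy; last exact: cr.
  by move=> /= xP _; apply: phi_range; rewrite // adj_sym.
move=> x y'; rewrite !in_setU1; case: (eqVneq x z) => [->|xz]; case: (eqVneq y' z) => [->|yz] //=.
- by rewrite nr_irr.
- by move=> _ y'P ny; rewrite Wz lowW //; apply: yQ; rewrite inE y'P.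
- by move=> xP _ nx; rewrite Wz lowW // eq_sym; apply: yQ; rewrite inE xP nr_sym.
by move=> xP yP; rewrite !lowW //; apply: cl.
Qed.


End Weights.

(** * Choice of the residue of the last edge *)

Lemma sum_count_residues t L (s l : seq nat) :
  uniq [seq a %% t | a <- s] ->
  \sum_(a <- s) count (fun v => v == a + L %[mod t]) l <= size l.
Proof.
move=> us; elim: l => [|v l IH]; first by rewrite big1.
rewrite /= big_split /= -add1n leq_add //.
have -> : \sum_(a <- s) (v == a + L %[mod t]) = count (fun a => v == a + L %[mod t]) s.
  by rewrite -sum1_count [RHS]big_mkcond; apply: eq_bigr => a _; case: ifP.
(* A value [v] is counted for at most one [a], the entries of [s] being distinct modulo [t]. *)
elim: s us {IH} => //= a s IHs /andP[ua us]; case: eqP => [E|_]; last by rewrite add0n IHs.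
rewrite add1n ltnS leqNgt -has_count; apply/hasPn => b bs.
apply: contra ua => /eqP E'; apply/mapP; exists b => //.
by apply/eqP; rewrite -(eqn_modDr L) -E E'.
Qed.

(** For a given residue, [u] has [du + 2] candidate sums and [v] windows of [dv]; [KU] and [KV]
    count the forbidden ones. The conclusion is what [window_escape] needs: one candidate for [u],
    and either three of them or a window for [v] with two free places. *)
Lemma exists_good_residue (s : seq nat) (KU KV : nat -> nat) (N D du dv : nat) :
  1 < dv -> 0 < du <= dv -> dv <= D <= N ->
  2 * N + (2 < D) + (D - du) + (D - dv) <= size s ->
  \sum_(a <- s) KU a <= du * N + (du + dv - 3) ->
  \sum_(a <- s) KV a <= dv * N + (du + dv - 3) ->
  exists a, [/\ a \in s, KV a < dv, KU a < du + 2 & KU a < du \/ (KV a).+1 < dv].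
Proof.
move=> dv1 du0 dvD szs HU HV.
pose pa a := dv <= KV a.
pose pg a := ~~ pa a && (du + 2 <= KU a).
pose pb a := [&& ~~ pa a, ~~ pg a, du <= KU a & dv - 1 <= KV a].
have := @bad_residues (\sum_(a <- s) pa a) (\sum_(a <- s) pb a) (\sum_(a <- s) pg a)
  (size s) N D du dv dv1 du0 dvD szs.
rewrite !big_distrl -!big_split /= => H.
have {}H : \sum_(a <- s) (pa a + pb a + pg a) < size s.
  apply: H; [apply: leq_trans HV | apply: leq_trans HU]; apply: leq_sum => a _.
    rewrite /pb /pg /pa; lia.
  rewrite /pb /pg /pa; lia.
have /hasP[a as_ Ha] : has (fun a => ~~ [|| pa a, pb a | pg a]) s.
  apply: contraLR H => /hasPn H; rewrite -leqNgt -sum1_size big_seq [X in _ <= X]big_seq.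
  apply: leq_sum => a /H; rewrite negbK.
  by case: (pa a); case: (pb a); case: (pg a).
exists a; split=> //; move: Ha; rewrite /pb /pg /pa; lia.
Qed.

(** * The last edge *)

Section LastEdge.
Variables (G : sgraph) (t : nat).
Implicit Types (c : G -> G -> nat) (P R : {set G}) (phi : G -> nat) (x y z w : G).

Lemma recolour_mod P z phi c :
  (forall x y, c x y = c y x) -> z \notin P ->
  (forall w, adj z w -> w \in P -> phi w = c z w %[mod t]) ->
  forall x y, adj x y -> coloured P x y -> recolour z phi c x y = c x y %[mod t].
Proof.
move=> cs zP H x y; rewrite /recolour /coloured.
case: (eqVneq x z) => [->|xz] xy; first by rewrite (negPf zP); apply: H.
case: (eqVneq y z) xy => [->|yz] xy //; rewrite (negPf zP) orbF => xP.
by rewrite cs H // adj_sym.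
Qed.

(** Meant for a component [A], so that the weights, taken over all neighbours, involve only edges
    inside [A]. *)
Definition distinguishing (nr : rel G) (A : {set G}) c : Prop :=
  [/\ forall x y, c x y = c y x,
      forall x y, x \in A -> y \in A -> adj x y -> 0 < c x y <= 3 * t,
      forall x y w, x \in A -> y \in A -> w \in A -> adj x y -> adj x w -> y != w ->
        c x y != c x w &
      forall x y, x \in A -> y \in A -> nr x y -> weight c x != weight c y].

Variable nr : rel G.
Variables (D N : nat).
Hypotheses (degD : forall x : G, degree x <= D) (DN : D <= N)
  (nr_sym : symmetric nr) (nr_irr : irreflexive nr)
  (adj_nr : forall x y, adj x y -> nr x y)
  (adj2_nr : forall x y z, adj x y -> adj y z -> x != z -> nr x z)
  (card_nr : forall x, #|[set y | nr x y]| <= degree x * N)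
  (tK : 2 * (N + D - 1) + (2 < D) <= t).

(** Once the residue of the colour of [uv] is fixed, sums are compared through their quotients by
    [t]. What remains free is the colour within its class and the sets [R], [R'] of raised
    neighbours of [u] and [v]. *)
Lemma partial_finish P c u v :
  partial t nr P c -> u \notin P -> v \notin P -> adj u v ->
  (forall w, adj u w -> w != v -> w \in P) -> (forall w, adj v w -> w != u -> w \in P) ->
  degree u <= degree v -> 1 < degree v ->
  exists c', distinguishing nr (u |: (v |: P)) c'.
Proof.
move=> [cs cp cm cr cl] uP vP uv uN vN duv dv1.
have vu : adj v u by rewrite adj_sym.
have nuv : u != v by apply: contraTneq uv => ->; rewrite adj_irr.
have nvu : v != u by rewrite eq_sym.
have du0 : 0 < degree u by apply/card_gt0P; exists v; rewrite inE.
have D0 : 1 < D by apply: leq_trans dv1 (degD v).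
have t0 : 0 < t by move: tK DN D0; clear; lia.
have neqP z w : z \notin P -> w \in P -> w != z by move=> zP; apply: contraTneq => ->.
pose nb z := [set w in P | adj z w].
have card_nb z z' : z' \notin P -> adj z z' -> (forall w, adj z w -> w != z' -> w \in P) ->
    #|nb z|.+1 = degree z.
  move=> zP zz' zN; rewrite /degree (cardsD1 z' [set w | adj z w]) inE zz' add1n; congr _.+1.
  apply: eq_card => w; rewrite !inE; case: (boolP (adj z w)) => zw; rewrite ?andbF ?andbT //.
  by case: (eqVneq w z') => [->|wz]; [rewrite (negPf zP) | rewrite zN].
have cBu : #|nb u|.+1 = degree u by apply: card_nb uv uN.
have cBv : #|nb v|.+1 = degree v by apply: card_nb vu vN.
have mid z w : z \notin P -> adj z w -> w \in P -> t < c z w <= 2 * t.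
  by move=> zP zw wP; rewrite cs; apply: cm; rewrite // adj_sym.
pose B := nb u :|: nb v.
have BP w : w \in B -> w \in P by rewrite !inE; case: (w \in P).
(* Neighbours of [u] or [v] may still be moved, so both values of their pair are forbidden; the
   other near vertices keep their weight. *)
pose kill z := [seq weight c w | w <- enum ([set w in P | nr z w] :\: B)] ++
  ([seq lowered t (weight c w) | w <- enum B] ++ [seq lowered t (weight c w) + t | w <- enum B]).
have size_kill z z' : nr z z' -> z' \notin P -> (forall w, w \in B -> nr z w) ->
    0 < degree z -> size (kill z) <= degree z * N + (degree u + degree v - 3).
  move=> zz' zP Bz dz0; rewrite !size_cat !size_map -!cardE.
  (* The other end of the last edge is near [z] but unprocessed, hence the strict inequality. *)
  have H1 : #|[set w in P | nr z w]| < degree z * N.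
    apply: leq_trans (card_nr z); apply: proper_card; apply/properP; split.
      by apply/subsetP => w; rewrite !inE => /andP[].
    by exists z'; rewrite !inE ?(negPf zP).
  have H2 : #|[set w in P | nr z w] :\: B| + #|B| = #|[set w in P | nr z w]|.
    rewrite -(cardsID B [set w in P | nr z w]) addnC; congr (_ + _); apply: eq_card => w.
    rewrite in_setI inE; case: (boolP (w \in B)) => wB; rewrite ?andbF // andbT.
    by rewrite Bz // BP.
  have H3 : #|B| <= #|nb u| + #|nb v| by apply: leq_card_setU.
  by move: H1 H2 H3 cBu cBv; clear; lia.
have size_kill_u : size (kill u) <= degree u * N + (degree u + degree v - 3).
  apply: (size_kill u v) => //; first exact: adj_nr.
  move=> w wB; have wP := BP w wB; move: wB; rewrite !inE wP /= => /orP[/adj_nr//|vw].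
  by apply: adj2_nr uv vw _; rewrite eq_sym neqP.
have size_kill_v : size (kill v) <= degree v * N + (degree u + degree v - 3).
  apply: (size_kill v u) => //; last by apply: ltnW.
    exact: adj_nr.
  move=> w wB; have wP := BP w wB; move: wB; rewrite !inE wP /= => /orP[uw|/adj_nr//].
  by apply: adj2_nr vu uw _; rewrite eq_sym neqP.
pose fr := [seq c u w %% t | w <- enum (nb u)] ++ [seq c v w %% t | w <- enum (nb v)].
pose clean := [seq a <- iota 1 t | a %% t \notin fr].
pose Lu := \sum_(w in nb u) (c u w - t * odd (weight c w %/ t)).
pose Mv := \sum_(w in nb v) c v w.
have uclean : uniq [seq a %% t | a <- clean].
  rewrite map_inj_in_uniq ?filter_uniq ?iota_uniq //.
  move=> a b; rewrite !mem_filter !mem_iota => /andP[_ Ha] /andP[_ Hb].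
  exact: eq_mod_window Ha Hb.
pose Kl z L a := [seq e <- kill z | e == a + L %[mod t]].
have sumK z L : \sum_(a <- clean) size (Kl z L a) <= size (kill z).
  by under eq_bigr do rewrite size_filter; apply: sum_count_residues.
have [] := @exists_good_residue clean (fun a => size (Kl u Lu a)) (fun a => size (Kl v Mv a))
   N D (degree u) (degree v) dv1.
- by rewrite du0.
- by rewrite degD.
- have := size_avoid t 1 fr; rewrite -/clean size_cat !size_map -!cardE.
  by move: tK cBu cBv (degD u) (degD v) DN dv1 du0; clear; lia.
- exact: leq_trans (sumK _ _) size_kill_u.
- exact: leq_trans (sumK _ _) size_kill_v.
move=> a [aclean KV KU KUV].
have [a_range a_fr] : 0 < a <= t /\ a %% t \notin fr.
  by move: aclean; rewrite mem_filter mem_iota add1n ltnS => /andP[-> ->].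
pose phiu (x : nat) R w := if w == v then x else flip t c u R w.
pose c1 (x : nat) R := recolour u (phiu x R) c.
(* A common neighbour of [u] and [v] may change its weight when [u] is recoloured, so [Lv] depends
   on [R]; modulo [t] it is always [Mv]. *)
pose Lv (x : nat) R := \sum_(w in nb v) (c1 x R v w - t * odd (weight (c1 x R) w %/ t)).
(* [Q y n]: the sum of [u] can lie in [t * y, t * y + t) while that of [v] can be
   any of the [degree v] values whose quotients by [t] start at [n]. *)
pose Q (y n : nat) := exists (x : nat) R, [/\ 0 < x <= 3 * t, x = a %[mod t], R \subset nb u,
   x + Lu + t * #|R| \notin kill u & y = (x + Lu + t * #|R|) %/ t /\ n = (x + Lv x R) %/ t].
(* Raising up to [degree u - 1] neighbours and taking [x] among [a], [a + t], [a + 2t] gives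
   [degree u + 2] consecutive quotients; [ys] keeps those of allowed sums. *)
pose ys := [seq (a + Lu) %/ t + m | m <- iota 0 (degree u + 2) & a + Lu + m * t \notin kill u].
pose Kc := [seq e %/ t | e <- Kl v Mv a].
have uys : uniq ys.
  by rewrite map_inj_uniq ?filter_uniq ?iota_uniq // => m m' /addnI.
have szys : degree u + 2 <= size ys + size (Kl u Lu a).
  rewrite size_map size_filter.
  rewrite -{1}(size_iota 0 (degree u + 2)).
  rewrite -(count_predC (fun m => a + Lu + m * t \notin kill u) (iota 0 (degree u + 2))).
  rewrite leq_add2l -size_filter -(size_map (fun m => a + Lu + m * t)).
  apply: uniq_leq_size => [|e /mapP[m]].
    rewrite map_inj_uniq ?filter_uniq ?iota_uniq // => m m' /addnI.
    by move/eqP; rewrite eqn_pmul2r // => /eqP.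
  rewrite mem_filter /= negbK => /andP[mk _] ->.
  by rewrite mem_filter mk andbT addnC modnMDl.
have [p [n [l [_ [x [R [x_range xa RB yk [yE nE]]]] ln lK ly]]]] :
    exists (y n l : nat), [/\ y \in ys, Q y n, n <= l < n + degree v, l \notin Kc & l != y].
  apply: window_escape => //.
  - by rewrite size_map.
  - by move: szys KU; clear; lia.
  - by rewrite size_map; move: szys KU KUV; clear; lia.
  move=> y /mapP[m]; rewrite mem_filter mem_iota => /andP[mk Hm] ->.
  (* Raise as many neighbours as possible; at most two steps are left for [x], which keeps it within
     [3 * t]. *)
  pose j := minn m (degree u - 1).
  have jB : j <= #|nb u| by move: cBu; rewrite /j; clear; lia.
  have [R RB Rj] := subset_of_card jB.
  exists (((a + (m - j) * t) + Lv (a + (m - j) * t) R) %/ t), (a + (m - j) * t), R.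
  have E : a + (m - j) * t + Lu + t * #|R| = a + Lu + m * t.
    have : j <= m by rewrite geq_minl.
    by rewrite Rj; clear; nia.
  split=> //.
  - have : m - j <= 2 by move: Hm du0; rewrite /j; clear; lia.
    by move: a_range; clear; nia.
  - by rewrite addnC modnMDl.
  - by rewrite E.
  by rewrite E [_ + m * t]addnC divnMDl // addnC.
(* Raising [l - n] neighbours of [v] brings the quotient of its sum from [n] to [l]. *)
have [R' RB' Rl] : exists2 R' : {set G}, R' \subset nb v & #|R'| = l - n.
  by apply: subset_of_card; move: ln cBv; clear; lia.
pose d1 := c1 x R; pose phiv w := if w == u then x else flip t d1 v R' w.
pose d2 := recolour v phiv d1.
have ds1 : forall y z, d1 y z = d1 z y by apply: recolour_sym.
have d1v w : w \in P -> d1 v w = c v w.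
  by move=> wP; rewrite /d1 /c1 /recolour (negPf nvu) (negPf (neqP _ _ uP wP)).
have phiuE w : w \in P -> phiu x R w = flip t c u R w.
  by move=> wP; rewrite /phiu (negPf (neqP _ _ vP wP)).
have phivE w : w \in P -> phiv w = flip t d1 v R' w.
  by move=> wP; rewrite /phiv (negPf (neqP _ _ uP wP)).
have tcu w : adj u w -> w \in P -> t <= c u w.
  by move=> uw wP; case/andP: (mid u w uP uw wP) => /ltnW.
have tcv w : adj v w -> w \in P -> t <= d1 v w.
  by move=> vw wP; rewrite d1v //; case/andP: (mid v w vP vw wP) => /ltnW.
have W1 w : w \in P -> weight d1 w =
    if adj u w then lowered t (weight c w) + t * (w \in R) else weight c w.
  by apply: weight_flip => // w' uw wP; rewrite phiuE // flipE ?tcu.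
have low1 w : w \in P -> lowered t (weight d1 w) = lowered t (weight c w).
  by move=> /W1->; case: ifP => // _; rewrite lowered_raise.
have W2 w : w \in P -> weight d2 w =
    if adj v w then lowered t (weight c w) + t * (w \in R') else weight d1 w.
  move=> wP; rewrite -low1 //; move: w wP; apply: weight_flip => // w' vw wP.
  by rewrite phivE // flipE ?tcv.
have sum_nb z z' (f : G -> nat) : z' \notin P -> adj z z' ->
    (forall w, adj z w -> w != z' -> w \in P) ->
    \sum_(w | adj z w) (if w == z' then x else f w) = x + \sum_(w in nb z) f w.
  move=> zP zz' zN; rewrite (bigD1 z') //= eqxx; congr (_ + _); apply: eq_big => [w|w].
    rewrite inE andbC; case: (boolP (adj z w)) => zw; rewrite ?andbF ?andbT //.
    by case: (eqVneq w z') => [->|wz]; [rewrite (negPf zP) | rewrite zN].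
  by case/andP=> _ /negPf->.
have Wu : weight d2 u = x + Lu + t * #|R|.
  (* Recolouring at [v] gives [uv] the colour [x] that it already has, so the weight of [u]
     stays. *)
  have := weight_recolour_adj phiv ds1 vu; rewrite /phiv eqxx.
  have -> : d1 v u = x by rewrite /d1 /c1 /recolour (negPf nvu) eqxx /phiu eqxx.
  move/addIn; rewrite -/d2 => ->; rewrite weight_recolour_self sum_nb // sum_flip ?addnA //.
  by move=> w; rewrite inE => /andP[wP uw]; apply: tcu.
have Wv : weight d2 v = x + Lv x R + t * (l - n).
  rewrite weight_recolour_self sum_nb // sum_flip ?addnA ?Rl //.
  by move=> w; rewrite inE => /andP[wP vw]; apply: tcv.
have Wkill z w : w \in P -> nr z w -> weight d2 w \in kill z.
  move=> wP zw; have inK b : w \in B -> lowered t (weight c w) + t * nat_of_bool b \in kill z.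
    move=> wB; rewrite !mem_cat; apply/orP; right; apply/orP; case: b.
      by right; rewrite muln1; apply/mapP; exists w; rewrite // mem_enum.
    by left; rewrite muln0 addn0; apply/mapP; exists w; rewrite // mem_enum.
  rewrite W2 //; case: ifPn => vw; first by apply: inK; rewrite !inE wP vw orbT.
  rewrite W1 //; case: ifPn => uw; first by apply: inK; rewrite !inE wP uw.
  rewrite mem_cat; apply/orP; left; apply/mapP; exists w => //.
  by rewrite mem_enum !inE wP zw (negPf uw) (negPf vw).
have cellv : weight d2 v %/ t = l.
  by rewrite Wv addnC mulnC divnMDl // -nE subnK //; case/andP: ln.
have killv : weight d2 v \notin kill v.
  (* The sum of [v] lies in the class of [a + Mv]; if it were forbidden, its quotient [l] would be
     in [Kc]. *)
  apply: contra lK => Wvk; apply/mapP; exists (weight d2 v); last by rewrite cellv.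
  rewrite mem_filter Wvk andbT; apply/eqP; rewrite -(modnDml a) -xa modnDml.
  have E : Mv = Lv x R + \sum_(w in nb v) odd (weight d1 w %/ t) * t.
    rewrite -big_split; apply: eq_bigr => w; rewrite inE => /andP[wP vw] /=.
    rewrite -/d1 d1v // mulnC subnK //; have := tcv w vw wP; rewrite d1v //.
    by rewrite mulnC; apply: leq_trans; case: odd; rewrite ?muln1 ?muln0.
  by rewrite Wv E -big_distrl addnA ![_ + _ * t]addnC [t * _]mulnC [_ + _ * t]addnC !modnMDl.
have weightuv : weight d2 u != weight d2 v.
  by apply: contraNneq ly => E; rewrite -cellv -E yE Wu.
have colP y z : y \in u |: (v |: P) -> z \in u |: (v |: P) -> adj y z ->
    [\/ coloured P y z, y = u /\ z = v | y = v /\ z = u].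
  rewrite !in_setU1 /coloured; case: (boolP (y \in P)) => [yP|_]; first by constructor 1.
  case: (boolP (z \in P)) => [zP|_]; first by rewrite orbT; constructor 1.
  rewrite !orbF => /orP[]/eqP-> /orP[]/eqP->; rewrite ?adj_irr // => _.
    by constructor 2.
  by constructor 3.
have d2mod y z : adj y z -> coloured P y z -> d2 y z = c y z %[mod t].
  move=> yz yzP; transitivity (d1 y z %% t).
    by apply: (recolour_mod (P := P)) => // w vw wP; rewrite phivE // flip_mod ?tcv.
  by apply: (recolour_mod (P := P)) => // w uw wP; rewrite phiuE // flip_mod ?tcu.
have d2uv : d2 u v = x by rewrite /d2 /recolour (negPf nuv) eqxx /phiv eqxx.
have ds2 : forall y z, d2 y z = d2 z y by apply: recolour_sym.
exists d2; split=> //.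
- move=> y z yA zA yz; case: (colP y z yA zA yz) => [yzP|[-> ->]|[-> ->]]; last 2 first.
  + by rewrite d2uv.
  + by rewrite ds2 d2uv.
  have ru w : adj u w -> w \in P -> 0 < d2 u w <= 3 * t.
    move=> uw wP; rewrite /d2 /recolour (negPf nuv) (negPf (neqP _ _ vP wP)).
    by rewrite /d1 /c1 /recolour eqxx phiuE // flip_range ?mid.
  have rv w : adj v w -> w \in P -> 0 < d2 v w <= 3 * t.
    by move=> vw wP; rewrite /d2 /recolour eqxx phivE // flip_range // d1v ?mid.
  have r y' z' : adj y' z' -> z' \in u |: (v |: P) -> y' \in P -> 0 < d2 y' z' <= 3 * t.
    move=> yz'; rewrite !in_setU1 => /or3P[/eqP E|/eqP E|zP'] yP'.
    + by rewrite E ds2 ru // adj_sym -E.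
    + by rewrite E ds2 rv // adj_sym -E.
    by rewrite /d2 /recolour (negPf (neqP _ _ vP yP')) (negPf (neqP _ _ vP zP'))
      /d1 /c1 /recolour (negPf (neqP _ _ uP yP')) (negPf (neqP _ _ uP zP')) cr.
  case/orP: yzP => [yP|zP]; first exact: r.
  by rewrite ds2 r // adj_sym.
(* Edges meeting [P] keep their residues, and the residue of [uv] was chosen outside [fr]. *)
- have px w : w \in P -> (adj u w -> x %% t != c u w %% t) /\ (adj v w -> x %% t != c v w %% t).
    move=> wP; rewrite xa; split=> zw; apply: contraNneq a_fr => ->; rewrite mem_cat; apply/orP;
      [left | right]; by apply/mapP; exists w; rewrite // mem_enum inE wP.
  have key y z w : adj y z -> adj y w -> z != w -> coloured P y w ->
      (y = u /\ z = v) \/ (y = v /\ z = u) -> d2 y z %% t != d2 y w %% t.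
    move=> yz yw zw ywP; rewrite (d2mod y w) // => -[] [E1 E2]; subst y z.
      rewrite d2uv; case: (px w) => [|/(_ yw)//]; by apply: uN; rewrite // eq_sym.
    rewrite ds2 d2uv; case: (px w) => [|_ /(_ yw)//]; by apply: vN; rewrite // eq_sym.
  move=> y z w yA zA wA yz yw zw; suff : d2 y z %% t != d2 y w %% t.
    by apply: contraNneq => ->.
  case: (colP y z yA zA yz) => [yzP|H|H]; case: (colP y w yA wA yw) => [ywP|H'|H'].
  + by rewrite !d2mod //; apply: cp.
  + by rewrite eq_sym; apply: key; rewrite 1?eq_sym //; left.
  + by rewrite eq_sym; apply: key; rewrite 1?eq_sym //; right.
  + by apply: key => //; left.
  + by case: H H' zw => [-> ->] [_ ->]; rewrite eqxx.
  + by case: H H' nuv => [-> _] [-> _]; rewrite eqxx.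
  + by apply: key => //; right.
  + by case: H H' nuv => [-> _] [-> _]; rewrite eqxx.
  by case: H H' zw => [-> ->] [_ ->]; rewrite eqxx.
have WuP z : z \in P -> nr u z -> weight d2 u != weight d2 z.
  by move=> zP uz; rewrite Wu; apply: contraNneq yk => ->; apply: Wkill.
have WvP z : z \in P -> nr v z -> weight d2 v != weight d2 z.
  by move=> zP vz; apply: contraNneq killv => ->; apply: Wkill.
move=> y z; rewrite !in_setU1 => /or3P[/eqP->|/eqP->|yP] /or3P[/eqP->|/eqP->|zP] yz //.
- by rewrite nr_irr in yz.
- exact: WuP.
- by rewrite eq_sym.
- by rewrite nr_irr in yz.
- exact: WvP.
- by rewrite eq_sym WuP // nr_sym.
- by rewrite eq_sym WvP // nr_sym.
(* The pairs of processed vertices have not changed, so unequal [lowered] weights still separate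
   them. *)
have low2 w : w \in P -> lowered t (weight d2 w) = lowered t (weight c w).
  by move=> wP; rewrite W2 //; case: ifP => _; rewrite ?lowered_raise ?low1.
apply: contraNneq (cl y z yP zP yz) => E.
by rewrite -(low2 y) // -(low2 z) // E.
Qed.

End LastEdge.

(** * From components to the whole graph *)

Section Assembly.
Variables (G : sgraph) (r : nat).
Hypotheses (niG : no_isolated_edge G) (r1 : 1 < r).
Implicit Types x y z u v w : G.

Let D := max_degree G.
Let N := \sum_(i < r) (D - 1) ^ i.
(** The extra unit for [D > 2] serves the residue count at the last edge; it costs 3 colours, paid
    by the last summand [D] of the bound. *)
Let t := 2 * (N + D - 1) + (2 < D).

Lemma degree_le_max x : degree x <= D.
Proof. exact: leq_bigmax. Qed.

Lemma max_degree_leq_geometric : D <= N.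
Proof.
rewrite /N; case: r r1 => [|[|n]] // _; rewrite !big_ord_recl /= expn0 expn1.
by lia.
Qed.

Lemma closer_neighbour v y : connect (@adj G) v y -> y != v ->
  exists2 z, adj y z & odflt 0 (distance v z) < odflt 0 (distance v y).
Proof.
have dist z n : walk n v z -> exists2 m, distance v z = Some m & m <= n.
  move=> Hn; have ex : exists n, walk n v z by exists n.
  case: (ex_minnP ex) => m Hm mm; exists m; last exact: mm.
  by apply/distanceP.
move=> vy yv; have [n Hn] := connect_walk vy; have [m Em _] := dist y n Hn.
have [/walkP[p [sp pP pl]] _] := (distanceP v y m).1 Em; rewrite Em /=.
case: p / (lastP p) sp pP pl => [|q y'] sp pP pl; first by rewrite -pl eqxx in yv.
move: sp pP pl; rewrite size_rcons rcons_path last_rcons => sp /andP[qP qy] y'y; subst y'.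
exists (last v q); first by rewrite adj_sym.
have [|m' -> /=] := dist (last v q) (size q); first by apply/walkP; exists q.
by rewrite -sp ltnS.
Qed.

(** Take [v] of maximal degree in the component and any neighbour [u]. If [v] had degree 1, so would
    [u], and [uv] would be an isolated edge. *)
Lemma component_edge x : 0 < degree x -> exists u v,
  [/\ v \in component x, adj u v, degree u <= degree v & 1 < degree v].
Proof.
move=> dx; have xx : x \in component x by rewrite inE connect0.
case: (@arg_maxnP _ x (mem (component x)) (@degree G) xx) => v vx vmax.
have [u] : exists u, u \in [set y | adj v y].
  by apply/card_gt0P/(leq_trans dx); apply: vmax.
rewrite inE => vu; have ux : u \in component x.
  by move: vx; rewrite !inE => vx; apply: connect_trans vx (connect1 vu).
have uv : adj u v by rewrite adj_sym.
exists u, v; split=> //; first exact: vmax.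
rewrite ltnNge; apply/negP => dv; apply: (@niG v).
have nb1 z z' : degree z <= 1 -> adj z z' -> forall w, adj z w -> w = z'.
  move=> dz zz' w zw; apply: contraTeq dz => wz; rewrite -ltnNge.
  by rewrite /degree (cardsD1 z') (cardsD1 w) !inE zz' zw wz.
have nbv := nb1 v u dv vu; have nbu := nb1 u v (leq_trans (vmax u ux) dv) uv.
apply: (@same_edges_isolated G v u).
- by apply: contraTneq vu => ->; rewrite adj_irr.
- exact: connect1.
move=> e /imset2P[a b _ ab ->]; have {}ab : adj a b := ab; rewrite !inE.
apply/orP/orP => -[]/eqP E; subst.
- by right; rewrite (nbv b).
- by left; rewrite (nbv a) // adj_sym.
- by right; rewrite (nbu b).
- by left; rewrite (nbu a) // adj_sym.
Qed.

Lemma component_colouring x :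
  exists c, distinguishing t (near r) (component x) c.
Proof.
have [dx|dx] := posnP (degree x).
  have only y : y \in component x -> y = x.
    rewrite inE => /connectP[[|z p] //= /andP[xz _] _].
    by move/eqP: dx; rewrite cards_eq0 => /eqP/setP/(_ z); rewrite !inE xz.
  exists (fun _ _ => 0); split=> //.
  - by move=> y z /only-> /only->; rewrite adj_irr.
  - by move=> y z w /only-> /only->; rewrite adj_irr.
  by move=> y z /only-> /only->; rewrite /near eqxx.
have [u [v [vx uv duv dv1]]] := component_edge dx.
have closed y z : y \in component x -> adj y z -> z \in component x.
  by rewrite !inE => xy yz; apply: connect_trans xy (connect1 yz).
have ux : u \in component x by apply: closed vx _; rewrite adj_sym.
have N0 : 0 < N by apply: leq_trans max_degree_leq_geometric; apply: leq_trans (degree_le_max v); apply: ltnW.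
have tK : 2 * (N + D - 1) <= t by rewrite leq_addr.
have nr_irr : irreflexive (@near G r) by move=> y; rewrite /near eqxx.
pose S := component x :\: [set u; v].
(* Processing by decreasing distance from [v] leaves the closer neighbour of each vertex
   unprocessed. *)
pose depth y := odflt 0 (distance v y).
have step k : k <= #|S| -> exists P : {set G}, [/\ P \subset S, #|P| = k,
    forall p y, p \in P -> y \in S :\: P -> depth y <= depth p &
    exists c, partial t (near r) P c].
  elim: k => [_|k IH kS].
    exists set0; split; rewrite ?sub0set ?cards0 //; first by move=> p y; rewrite inE.
    exists (fun _ _ => 0); split=> // y z; rewrite ?inE //.
    by move=> w; rewrite /coloured !inE.
  have [P [PS Pk Pd [c Pc]]] := IH (ltnW kS).
  have [z0 z0S] : exists z0, z0 \in S :\: P.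
    apply/card_gt0P; rewrite cardsD (setIidPr PS) Pk subn_gt0 //.
  case: (@arg_maxnP _ z0 (mem (S :\: P)) depth z0S) => z zS zmax.
  have [zP zS'] : z \notin P /\ z \in S by move: zS; rewrite /= in_setD => /andP[].
  have [zv zx] : z != v /\ z \in component x.
    by move: zS'; rewrite !inE negb_or => /andP[/andP[]].
  have [|z' zz' dz] := @closer_neighbour v z _ zv.
    move: vx zx; rewrite !inE => vx; apply: connect_trans.
    by rewrite (sym_connect_sym (@adj_sym G)).
  have z'P : z' \notin P.
    by apply: contraL dz => z'P; rewrite -leqNgt; apply: Pd z'P zS.
  have [c' Pc'] := partial_extend degree_le_max N0 (@near_sym G r) nr_irr
    (fun y y' => @near_adj G r y y' (ltnW r1)) (card_near degree_le_max r) tK Pc zP zz' z'P.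
  exists (z |: P); split.
  - by apply/subsetP => y; rewrite in_setU1 => /predU1P[->//|/(subsetP PS)].
  - by rewrite cardsU1 zP Pk.
  - move=> p y; rewrite in_setU1 in_setD in_setU1 negb_or => Hp /andP[/andP[yz yP] yS].
    have yD : y \in S :\: P by rewrite in_setD yP.
    by case/predU1P: Hp => [->|pP]; [apply: zmax | apply: Pd pP yD].
  by exists c'.
have [P [PS Pk _ [c Pc]]] := step #|S| (leqnn _).
have {PS Pk}PE : P = S by apply/eqP; rewrite eqEcard PS Pk /=.
subst P; have inS w : w \in component x -> w != u -> w != v -> w \in S.
  by move=> wx wu wv; rewrite in_setD wx !inE negb_or wu wv.
have nadj y z : adj y z -> z != y by apply: contraTneq => ->; rewrite adj_irr.
have [||||c' Hc'] := partial_finish degree_le_max max_degree_leq_geometric (@near_sym G r) nr_irr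
    (fun y y' => @near_adj G r y y' (ltnW r1)) (fun y y' y'' => @near_adj2 G r y y' y'' r1)
    (card_near degree_le_max r) (leqnn t) Pc _ _ uv _ _ duv dv1.
- by rewrite !inE eqxx.
- by rewrite !inE eqxx orbT.
- by move=> w uw wv; apply: inS => //; [apply: closed ux uw | apply: nadj].
- by move=> w vw wu; apply: inS => //; [apply: closed vx vw | apply: nadj].
exists c'; suff -> : component x = u |: (v |: S) by [].
apply/setP => w; rewrite /S; rewrite !in_setU1 in_setD in_set2 negb_or.
by case: (eqVneq w u) => [->|_]; rewrite ?ux //; case: (eqVneq w v) => [->|_]; rewrite ?vx.
Qed.

Lemma near_connect x y : near r x y -> connect (@adj G) x y.
Proof. by case/nearP=> _ [p [pP pl _]]; apply/connectP; exists p. Qed.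

Lemma within_distance_near x y : within_distance r x y -> near r x y.
Proof.
rewrite /within_distance; case E: (distance x y) => [n|//] /andP[n0 nr].
have [/walkP[p [sp pP pl]] nmin] := (distanceP x y n).1 E.
apply/nearP; split; last by exists p; rewrite sp.
move=> xy; have : walk 0 x y by apply/walkP; exists [::]; rewrite xy.
by move/nmin; rewrite leqNgt n0.
Qed.

(** Near vertices have the same root, so the colourings chosen for the roots can be glued. *)
Lemma distinguishing_colouring : exists c : G -> G -> nat,
  [/\ forall x y, adj x y -> c x y = c y x,
      forall x y, adj x y -> 0 < c x y <= 3 * t,
      forall x y w, adj x y -> adj x w -> y != w -> c x y != c x w &
      forall x y, near r x y -> weight c x != weight c y].
Proof.
have [f Hf] := fin_all_exists component_colouring.
have csym := sym_connect_sym (@adj_sym G).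
pose rt x := fingraph.root (@adj G) x.
have rtE x y : connect (@adj G) x y -> rt x = rt y.
  by move=> xy; apply/eqP; rewrite root_connect.
have rt_in x : x \in component (rt x) by rewrite inE csym connect_root.
have rt_in' x y : connect (@adj G) x y -> y \in component (rt x).
  by move=> /rtE->; apply: rt_in.
exists (fun x y => f (rt x) x y); split.
- by move=> x y /connect1/rtE<-; case: (Hf (rt x)).
- by move=> x y xy; case: (Hf (rt x)) => _ H _ _; apply: H => //; apply: rt_in'; rewrite ?connect0 ?connect1.
- by move=> x y w xy xw yw; case: (Hf (rt x)) => _ _ H _; apply: H => //; apply: rt_in'; rewrite ?connect0 ?connect1.
move=> x y xy; have xy' := near_connect xy.
have -> : weight (fun x y => f (rt x) x y) x = weight (f (rt x)) x by [].
have -> : weight (fun x y => f (rt x) x y) y = weight (f (rt x)) y by rewrite (rtE _ _ xy').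
by case: (Hf (rt x)) => _ _ _ H; apply: H => //; apply: rt_in'; rewrite ?connect0.
Qed.

Lemma colourable_bound k : 3 * t <= k -> colourable G r k.
Proof.
move=> tk; have [c [cs cr cp cw]] := distinguishing_colouring.
(* The double maximum reads [c] off an unordered edge: its only terms are [c x y] and [c y x], which
   agree. *)
pose C (e : {set G}) := \max_(x in e) \max_(y in e | adj x y) c x y.
have CE x y : adj x y -> C [set x; y] = c x y.
  move=> xy; apply/eqP; rewrite eqn_leq; apply/andP; split.
    apply/bigmax_leqP => z /set2P[]-> ; apply/bigmax_leqP => w /andP[/set2P[]->];
      rewrite ?adj_irr //.
    by rewrite -cs.
  apply: (@leq_trans (\max_(w in [set x; y] | adj x w) c x w)).
    by apply: (@leq_bigmax_cond _ (fun w => (w \in [set x; y]) && adj x w)); rewrite !inE eqxx orbT.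
  by apply: (@leq_bigmax_cond _ (fun w => w \in [set x; y])); rewrite !inE eqxx.
have edgeP e : e \in edges G -> exists x y, adj x y /\ e = [set x; y].
  by by case/imset2P=> x y _ xy ->; exists x, y.
have edge_at e x : e \in edges G -> x \in e -> exists2 y, adj x y & e = [set x; y].
  move=> /edgeP[y [z [yz ->]]] /set2P[]->; first by exists z.
  by exists y; [rewrite adj_sym | rewrite setUC].
have sumE x : vertex_sum C x = weight c x.
  transitivity (\sum_(e in [set [set x; y] | y in [set y | adj x y]]) C e).
    apply: eq_bigl => e; apply/andP/imsetP => [[eE xe]|[y]].
      by have [y xy ->] := edge_at e x eE xe; exists y; rewrite // inE.
    by rewrite inE => xy ->; rewrite edge_mem ?inE ?eqxx.
  rewrite big_imset /=.
    by apply: eq_big => [y|y]; rewrite inE // => /CE.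
  move=> y z; rewrite !inE => xy _ E; have : y \in [set x; z] by rewrite -E !inE eqxx orbT.
  by case/set2P=> // yx; rewrite yx adj_irr in xy.
apply/colourableP; exists C; apply/and3P; split.
- apply/forall_inP => e /edgeP[x [y [xy ->]]]; rewrite CE //.
  by case/andP: (cr x y xy) => -> /leq_trans->.
- apply/forall_inP => e eE; apply/forall_inP => e' eE'; apply/implyP => /andP[ee'].
  case/set0Pn => x /setIP[xe xe'].
  have [y xy E] := edge_at e x eE xe; have [z xz E'] := edge_at e' x eE' xe'; subst e e'.
  by rewrite !CE //; apply: cp => //; apply: contraNneq ee' => ->.
apply/forallP => x; apply/forallP => y; apply/implyP => /within_distance_near.
by rewrite !sumE; apply: cw.
Qed.

Lemma sum_dist_index_le : sum_dist_index r niG <= 3 * t.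
Proof.
rewrite /sum_dist_index; case: ex_minnP => m _; apply.
exact: colourable_bound.
Qed.

End Assembly.

(** * The explicit bounds *)

Lemma sum_dist_index_bound (G : sgraph) (r : nat) (niG : no_isolated_edge G) :
  1 < r -> 1 < max_degree G ->
  sum_dist_index r niG <=
  6 * (\sum_(i < r) (max_degree G - 1) ^ i + max_degree G - 1) + max_degree G.
Proof.
move=> r1 D1; apply: leq_trans (sum_dist_index_le niG r1) _.
by move: D1; clear; case: (ltnP 2); lia.
Qed.

Lemma moore_boundE (D r : nat) :
  moore_bound D r = 1 + D * \sum_(i < r) (D - 1) ^ i.
Proof. by rewrite /moore_bound big_mkord big_distrr. Qed.

(** With [d = D - 1], at [r = 4] the right side exceeds the first summand by [6 (2 d^2 + d) >= D];
    afterwards each new power of [d] is at most the growth [d (d + 1)^(r - 1)] of [D^(r - 1)]. *)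
Lemma geometric_bound (D r : nat) : 1 < D -> 3 < r ->
  6 * (\sum_(i < r) (D - 1) ^ i + D - 1) + D <= 6 * D ^ (r - 1).
Proof.
case: D => [|d] // d0 r3; have -> : r = (r - 4).+4 by lia.
rewrite !subn1 addnS /=.
elim: (r - 4) => [|n IH].
  by rewrite !big_ord_recr big_ord0 /= add0n !expnS expn0; clear -d0; nia.
have H : d ^ n.+4 <= d * d.+1 ^ n.+3.
  by rewrite expnS leq_mul2l leq_exp2r ?leqnSn ?orbT.
rewrite big_ord_recr [d.+1 ^ n.+1.+3]expnS mulSn /=.
move: (d ^ n.+4) (d.+1 ^ n.+3) (\sum_(i < n.+4) d ^ i) H IH => p q S.
by clear; lia.
Qed.

Import Order.TTheory GRing.Theory Num.Theory.
Local Open Scope ring_scope.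

Theorem theorem1 (G : sgraph) (niG : no_isolated_edge G)
    (hD : (2 <= max_degree G)%N) :
  let D : rat := (max_degree G)%:R in
  let chi (r : nat) : rat := (sum_dist_index r niG)%:R in
  [/\ forall r : nat, (2 <= r)%N ->
        chi r <= 6 * (((moore_bound (max_degree G) r)%:R - 1) / D + D - 1) + D,
      forall r : nat, (4 <= r)%N -> chi r <= 6 * D ^+ (r - 1)%N,
      chi 3%N <= 6 * D ^+ 2 + D
    & chi 2%N <= 13 * D - 6].
Proof.
move=> D chi; have D0 : D != 0 by rewrite pnatr_eq0 -lt0n ltnW.
have D1 : (0 < max_degree G)%N by apply: ltnW.
split=> [r r2|r r4||].
(* Since [M - 1 = D * N], the division is exact and the inequality is one of naturals. *)
- have -> : (moore_bound (max_degree G) r)%:R - 1 =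
      D * (\sum_(i < r) (max_degree G - 1) ^ i)%N%:R.
    by rewrite moore_boundE natrD addrC addKr natrM.
  rewrite [D * _]mulrC mulfK // /chi /D -natrD -(natrB _ (n := 1)) ?addn_gt0 ?D1 ?orbT //.
  rewrite -natrM -natrD ler_nat.
  exact: sum_dist_index_bound.
- rewrite -natrX -natrM ler_nat.
  apply: leq_trans (sum_dist_index_bound niG _ hD) (geometric_bound hD r4).
  exact: leq_trans r4.
(* Here the bracket is [1 + 2 (D - 1) + (D - 1)^2 = D^2]. *)
- rewrite -natrX -natrM -natrD ler_nat; apply: leq_trans (sum_dist_index_bound niG _ hD) _ => //.
  rewrite !big_ord_recr big_ord0 /= !expnS !expn0; move: (max_degree G) hD; clear; nia.
rewrite -natrM -natrB; last by move: hD; clear; lia.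
rewrite ler_nat; apply: leq_trans (sum_dist_index_bound niG _ hD) _ => //.
rewrite !big_ord_recr big_ord0 /= !expnS !expn0; move: (max_degree G) hD; clear; lia.
Qed.
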